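(* Let $(x^k)_{k\in\mathbb{N}}$ be the sequence generated by the absolute-error method (defined in the context) with stepsizes $$\alpha_k=\gamma_k\,\frac{(f+g)(x^k)-s_k-\epsilon_k}{\|u^k+w^k\|^2},$$ where $0<\underline{\gamma}\le\gamma_k\le\overline{\gamma}<2$ for all $k$, $(s_k)_{k\in\mathbb{N}}$ is a monotone decreasing real sequence converging to some $\tilde{s}\in\mathbb{R}$ with $s_k+\epsilon_k<(f+g)(x^k)$ for every $k$, and $w^k\in\partial g(x^k)$ are such that, for some constant $c>0$, $\max\{\|\overline{w}^k\|,\|w^k\|,\|u^k\|\}\le c$ for all $k$. Assume $\lim_{k\to\infty}\epsilon_k=\epsilon$ for some $\epsilon\in[0,\infty)$, and that the level set $L_{f+g}(\tilde{s}):=\{x\in C: f(x)+g(x)\le\tilde{s}\}$ is nonempty. Then: (i) $(x^k)_{k\in\mathbb{N}}$ is quasi-Fejér convergent to $L_{f+g}(\tilde{s})$; (ii) $\lim_{k\to\infty}(f+g)(x^k)=\tilde{s}+\epsilon$. If in addition $\epsilon=0$, then: (iii) $(x^k)_{k\in\mathbb{N}}$ converges weakly to some point in $L_{f+g}(\tilde{s})$.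
   Context: $\mathbb{H}$ is a real Hilbert space; $f,g:\mathbb{H}\to\,]-\infty,\infty]$ are proper closed (lower semicontinuous) convex functions with domains $\mathrm{dom}\,f=\{x: f(x)<\infty\}$ and $\mathrm{dom}\,g$ (defined likewise); $C\subseteq\mathbb{H}$ is nonempty, closed and convex; $\mathrm{dom}\,g\subseteq\mathrm{dom}\,f$ and $C\subseteq\mathrm{int}(\mathrm{dom}\,g)$. $P_C$ is the orthogonal projection onto $C$. For $\epsilon\ge0$ and a convex function $h$, $\partial_\epsilon h(x)=\{v: h(x')\ge h(x)+\langle v,x'-x\rangle-\epsilon\ \ \forall x'\in\mathbb{H}\}$ and $\partial h=\partial_0h$. A sequence $(x^k)$ is quasi-Fejér convergent to a nonempty set $S\subseteq\mathbb{H}$ if for every $x\in S$ there is a summable real sequence $(\rho_k)\in\ell_1(\mathbb{R})$ with $\|x^{k+1}-x\|^2\le\|x^k-x\|^2+\rho_k$ for all $k\ge0$. Absolute-error method: given $x^0\in C$, $(r_k)\subset[0,\infty)$ with $\sum_k r_k^2<\infty$, stepsizes $\alpha_k>0$ and $(\epsilon_k)\subset[0,\infty)$, for $k=0,1,\dots$: (1) $y^k=x^k-\alpha_ku^k$ with $u^k\in\partial_{\epsilon_k}f(x^k)$; (2) compute $\overline{x}^k,\overline{w}^k$ with $\overline{w}^k\in\partial g(\overline{x}^k)$ and $\|\alpha_k\overline{w}^k+\overline{x}^k-y^k\|\le r_k$; (3) $x^{k+1}=P_C(y^k-\alpha_k\overline{w}^k)$. *)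

(* Defs.v *)
From HB Require Import structures.
From mathcomp Require Import all_boot all_order all_algebra.
From mathcomp Require Import all_classical all_reals all_analysis.

Set Implicit Arguments.
Unset Strict Implicit.
Unset Printing Implicit Defensive.

Import Order.TTheory GRing.Theory Num.Theory.
Import numFieldNormedType.Exports.

Local Open Scope classical_set_scope.
Local Open Scope ring_scope.

(* A real Hilbert space is a complete normed space H together with an inner
   product (a positive definite symmetric bilinear form) inducing its norm. *)
Definition induces_norm (R : realType) (H : completeNormedModType R)
    (ip : {dot H for idfun}) : Prop :=
  forall x : H, ip x x = `|x| ^+ 2.

Section ExtendedRealFunctions.
Variables (R : realType) (H : completeNormedModType R).
Local Open Scope ereal_scope.

Definition dom (h : H -> \bar R) : set H := [set x | h x < +oo].

Definition proper_fun (h : H -> \bar R) : Prop :=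
  (forall x, -oo < h x) /\ dom h !=set0.

(* Meant for functions with values in ]-oo, +oo], so that the right-hand side
   never involves +oo - oo. *)
Definition convex_efun (h : H -> \bar R) : Prop :=
  forall (x y : H) (t : R), (0 < t < 1)%R ->
    h (t *: x + (1 - t) *: y)%R <= t%:E * h x + (1 - t)%:E * h y.

Definition proper_closed_convex (h : H -> \bar R) : Prop :=
  [/\ proper_fun h, lower_semicontinuous h & convex_efun h].

Definition subdiff (ip : {dot H for idfun}) (eps : R) (h : H -> \bar R)
    (x : H) : set H :=
  [set v | forall x', h x + (ip v (x' - x)%R)%:E - eps%:E <= h x'].

Definition level_set (C : set H) (h : H -> \bar R) (a : R) : set H :=
  [set x | C x /\ h x <= a%:E].

End ExtendedRealFunctions.

Section HilbertSequences.
Variables (R : realType) (H : completeNormedModType R).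

(* p = P_C z. *)
Definition is_projection (C : set H) (z p : H) : Prop :=
  C p /\ forall q, C q -> `|z - p| <= `|z - q|.

Definition quasi_Fejer (x : nat -> H) (S : set H) : Prop :=
  S !=set0 /\
  forall z, S z -> exists2 rho : R^nat,
    cvgn [normed series rho] &
    forall k, `|x k.+1 - z| ^+ 2 <= `|x k - z| ^+ 2 + rho k.

Definition weakly_cvg (ip : {dot H for idfun}) (x : nat -> H) (l : H) : Prop :=
  forall v : H, ip (x k) v @[k --> \oo] --> ip l v.

Record absolute_error_method (ip : {dot H for idfun}) (f g : H -> \bar R)
    (C : set H) (r alpha eps : R^nat) (x y u xbar wbar : nat -> H) : Prop := {
  aem_start : C (x 0%N);
  aem_r_ge0 : forall k, 0 <= r k;
  aem_r_sum : cvgn (series (fun k => r k ^+ 2));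
  aem_alpha_gt0 : forall k, 0 < alpha k;
  aem_eps_ge0 : forall k, 0 <= eps k;
  aem_u : forall k, subdiff ip (eps k) f (x k) (u k);
  aem_y : forall k, y k = x k - alpha k *: u k;
  aem_wbar : forall k, subdiff ip 0 g (xbar k) (wbar k);
  aem_error : forall k, `|alpha k *: wbar k + xbar k - y k| <= r k;
  aem_step : forall k, is_projection C (y k - alpha k *: wbar k) (x k.+1) }.

End HilbertSequences.

(* Main.v *)
Require Import Defs.
From mathcomp Require Import all_boot all_order all_algebra.
From mathcomp Require Import all_classical all_reals all_analysis.
From mathcomp Require Import ring lra.

Import Order.TTheory GRing.Theory Num.Theory.
Import numFieldNormedType.Exports.

Local Open Scope classical_set_scope.
Local Open Scope ring_scope.

Set Implicit Arguments.
Unset Strict Implicit.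
Unset Printing Implicit Defensive.

(** Write [F = f + g] and [phi k = F (x k) - s k - eps k > 0], and let [z] be a
    point of the level set [F <= stilde] of [C].

    The inexact proximal step is compared with an explicit subgradient step at
    [x k]: replacing the subgradient [wbar k] at [xbar k] by [w k] at [x k]
    costs, by monotonicity of the subdifferential of [g] and Young's inequality,
    only the square of the error tolerance ([one_step_estimate]):
      |x (k+1) - z|^2 <= |x k - z|^2 - 2 alpha (F (x k) - F z - eps)
                         + alpha^2 |u + w|^2 + r^2.
    As [F z <= stilde <= s k], the linear term is at least [2 alpha phi], and the
    Polyak-type stepsize [alpha = gamma phi / |u + w|^2] leaves
      |x (k+1) - z|^2 <= |x k - z|^2 - K phi^2 + r^2
    with [K = gamma_lo (2 - gamma_hi) / (4 c^2) > 0]. This is quasi-Fejer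
    convergence with the summable errors [r^2]; and a nonnegative sequence that
    decreases up to a summable error converges while its decrements vanish
    ([perturbed_decrease]), so [phi] tends to 0, that is, [F (x k)] tends to
    [stilde + epslim].

    Weak convergence is Opial's argument, with weak sequential compactness
    replaced by asymptotic hulls. The asymptotic hull of a sequence is the
    intersection of the closed convex sets that eventually contain it; it is
    nonempty for a bounded sequence because nested bounded closed convex sets of
    a Hilbert space meet ([nested_closed_convex_meet]). Since level sets of [F]
    in [C] are closed and convex, the hull of [x] lies in the level set
    [F <= stilde] when [epslim = 0]. There all distances [|x k - z|] converge,
    and this forces the hull of every subsequence to be one and the same point,
    the weak limit ([weak_convergence_criterion]). *)

(** * Convex sets *)

Section Convexity.
Variables (R : realType) (V : lmodType R).

Lemma convex_setP (D : set V) :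
  convex_set (D : set (convex_lmodType V)) <->
  forall (p q : V) (t : R), 0 < t < 1 -> D p -> D q ->
    D (t *: p + (1 - t) *: q).
Proof.
split=> [cD p q t /andP[t0 t1] Dp Dq|cD].
  have := cD p q (Itv01 (ltW t0) (ltW t1)).
  by rewrite !inE; apply.
apply/convex_setW => p q; rewrite !inE => Dp Dq t t0 t1.
by apply/mem_set/cD => //; rewrite t0 t1.
Qed.

End Convexity.

(** * Sequences decreasing up to a summable error *)

(** The sequence [V - series rho] is nonincreasing and bounded below, hence
    convergent, and its successive differences dominate [b]. *)
Lemma perturbed_decrease (R : realType) (V b rho : R^nat) :
  (forall k, 0 <= V k) -> (forall k, 0 <= b k) -> cvgn (series rho) ->
  (forall k, V k.+1 <= V k - b k + rho k) ->
  cvgn V /\ b k @[k --> \oo] --> 0.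
Proof.
move=> V0 b0 crho step.
pose W := V \- series rho.
have WS k : W k.+1 <= W k - b k.
  by rewrite /W /= seriesSr; have := step k; lra.
have cW : cvgn W.
  apply: nonincreasing_is_cvgn.
    by apply/nonincreasing_seqP => k; have := WS k; have := b0 k; lra.
  have [M [_ /(_ (M + 1))]] := cvg_seq_bounded crho.
  rewrite ltrDl => /(_ ltr01) bM; exists (- (M + 1)) => _ [k _ <-].
  have := bM k I; rewrite /= ler_norml => /andP[_].
  by rewrite /W /=; have := V0 k; lra.
split.
  have -> : V = W \+ series rho by apply/funext => k; rewrite /W /= subrK.
  exact: is_cvgD.
have lim0 : W k - W k.+1 @[k --> \oo] --> 0.
  rewrite -(subrr (limn W)); apply: cvgB; first exact: cW.
  by have := cW; rewrite -(cvg_shiftS W).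
apply: squeeze_cvgr (cvg_cst 0) lim0.
by apply: nearW => k; rewrite b0 /=; have := WS k; lra.
Qed.

(** * Inner product identities and projections *)

Section Hilbert.
Variables (R : realType) (H : completeNormedModType R).
Variable ip : {dot H for idfun}.
Hypothesis hip : induces_norm ip.
Implicit Types (p q v z : H) (D : set H).

Lemma ip_sym p q : ip p q = ip q p.
Proof. by rewrite (hermC ip) mul1r. Qed.

Lemma ipDl p q v : ip (p + q) v = ip p v + ip q v.
Proof. exact: linearDl. Qed.

Lemma ipNl p v : ip (- p) v = - ip p v.
Proof. exact: linearNl. Qed.

Lemma ipZl (t : R) p v : ip (t *: p) v = t * ip p v.
Proof. exact: linearZl_LR. Qed.

Lemma ipDr p q v : ip v (p + q) = ip v p + ip v q.
Proof. exact: linearDr. Qed.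

Lemma ipNr p v : ip v (- p) = - ip v p.
Proof. exact: linearNr. Qed.

Lemma ipZr (t : R) p v : ip v (t *: p) = t * ip v p.
Proof. by rewrite ip_sym ipZl ip_sym. Qed.

Let ipE := (ipDl, ipNl, ipZl, ipDr, ipNr, ipZr).

Lemma sqnormD p q : `|p + q| ^+ 2 = `|p| ^+ 2 + 2 * ip p q + `|q| ^+ 2.
Proof. by rewrite -!hip !ipE (ip_sym q p); ring. Qed.

Lemma sqnormB p q : `|p - q| ^+ 2 = `|p| ^+ 2 - 2 * ip p q + `|q| ^+ 2.
Proof. by rewrite -!hip !ipE (ip_sym q p); ring. Qed.

(** By polarization, continuity of the inner product reduces to that of the
    norm. *)
Lemma continuous_ip v : continuous (ip ^~ v).
Proof.
have -> : ip ^~ v = fun p =>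
    2^-1 * (`|p + v| * `|p + v| - `|p| * `|p| - `|v| ^+ 2).
  apply/funext => p; rewrite -!expr2 sqnormD.
  by field.
move=> p; apply: cvgM; first exact: cvg_cst.
have cn q : `|z + q| @[z --> p] --> `|p + q|.
  by apply: cvg_norm; apply: cvgD => //; exact: cvg_cst.
apply: cvgB; last exact: cvg_cst.
apply: cvgB; first by apply: cvgM; exact: cn.
by apply: cvgM; apply: cvg_norm.
Qed.

(** Moving from the projection [p] a little towards [z], inside [D], cannot
    decrease the distance to [q]; to first order this says that the angle at [p]
    between [q] and [z] is obtuse, whence the inequality by the law of
    cosines. *)
Lemma projection_nonexpansive D q p z :
  convex_set (D : set (convex_lmodType H)) -> is_projection D q p -> D z ->
  `|p - z| ^+ 2 <= `|q - z| ^+ 2.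
Proof.
move=> /convex_setP cD [Dp pmin] Dz.
have first_order t : 0 < t < 1 -> 2 * ip (q - p) (z - p) <= t * `|z - p| ^+ 2.
  move=> t01; have /andP[t0 t1] := t01.
  have : `|q - p| ^+ 2 <= `|(q - p) - t *: (z - p)| ^+ 2.
    rewrite ler_sqr ?nnegrE//.
    have -> : (q - p) - t *: (z - p) = q - (t *: z + (1 - t) *: p).
      by rewrite -addrA -opprD scalerBl scale1r scalerBr [in RHS]addrCA.
    exact: pmin (cD z p t t01 Dz Dp).
  rewrite (sqnormB (q - p)) ipZr normrZ exprMn (gtr0_norm t0) => h.
  by rewrite -(ler_pM2l t0); nra.
have obtuse : ip (q - p) (z - p) <= 0.
  rewrite leNgt; apply/negP => a0.
  have b0 : 0 <= `|z - p| ^+ 2 by exact: sqr_ge0.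
  set a := ip _ _ in a0 first_order; set b := `|z - p| ^+ 2 in b0 first_order.
  have ab : 0 < a + b + 1 by lra.
  (* Any [t] in ]0, 1[ with [t * b < 2 * a] gives a contradiction. *)
  have t01 : 0 < a / (a + b + 1) < 1.
    by rewrite divr_gt0//= ltr_pdivrMr//; lra.
  have := first_order _ t01; rewrite mulrAC ler_pdivlMr//; nra.
have -> : q - z = (q - p) - (z - p) by rewrite opprB addrA subrK.
rewrite (sqnormB (q - p)) distrC; have := sqr_ge0 `|q - p|; lra.
Qed.

(** * The one-step estimate *)

Lemma subdiff_fine (eps : R) (h : H -> \bar R) p q v :
  h p \is a fin_num -> h q \is a fin_num -> subdiff ip eps h p v ->
  fine (h p) + ip v (q - p) - eps <= fine (h q).
Proof. by move=> hp hq /(_ q); rewrite -lee_fin EFinB EFinD !fineK. Qed.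

(** The subgradient inequalities of [f] at [x] against [z], of [g] at [xbar]
    against [z] and of [g] at [x] against [xbar], each multiplied by [2 * a], are
    added to the nonexpansiveness of the projection. What remains besides
    [a ^+ 2 * `|u + w| ^+ 2] is [2 a <wbar - w, e> - a ^+ 2 |wbar - w| ^+ 2],
    with [e] the residual of the inexact step, and this is at most [|e| ^+ 2]. *)
Lemma one_step_estimate (f g : H -> \bar R) (C : set H) (eps a r : R)
    (x z u w xbar wbar x' : H) :
  convex_set (C : set (convex_lmodType H)) -> C z -> 0 < a ->
  (forall p, -oo < g p)%E ->
  f x \is a fin_num -> g x \is a fin_num ->
  f z \is a fin_num -> g z \is a fin_num ->
  subdiff ip eps f x u -> subdiff ip 0 g x w -> subdiff ip 0 g xbar wbar ->
  `|a *: wbar + xbar - (x - a *: u)| <= r ->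
  is_projection C (x - a *: u - a *: wbar) x' ->
  `|x' - z| ^+ 2 <= `|x - z| ^+ 2
    - 2 * a * (fine (f x) + fine (g x) - (fine (f z) + fine (g z)) - eps)
    + a ^+ 2 * `|u + w| ^+ 2 + r ^+ 2.
Proof.
move=> cC Cz a0 gNy fx gx fz gz uf wg wbarg err proj.
have gxbar : g xbar \is a fin_num.
  rewrite fin_numElt gNy/=; have := wbarg z; rewrite -(fineK gz).
  case: (g xbar) (gNy xbar) => [s _ _|_|//]; first exact: ltry.
  by rewrite addye// addye// leye_eq.
have Fu := subdiff_fine fx fz uf.
have Fw := subdiff_fine gx gxbar wg.
have Fwbar := subdiff_fine gxbar gz wbarg.
have {}proj := projection_nonexpansive cC proj Cz.
have {}err : `|a *: wbar + xbar - (x - a *: u)| ^+ 2 <= r ^+ 2.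
  by rewrite ler_sqr ?nnegrE// (le_trans _ err).
have young := sqr_ge0 `|(a *: wbar + xbar - (x - a *: u)) - a *: (wbar - w)|.
apply: le_trans proj _.
(* All terms are now expanded in the Gram matrix of x, z, xbar, u, w, wbar. *)
move: Fu Fw Fwbar err young; rewrite -!(hip _) !ipE.
rewrite ?(ip_sym z x, ip_sym z u, ip_sym z w, ip_sym z wbar,
  ip_sym xbar x, ip_sym xbar u, ip_sym xbar w, ip_sym xbar wbar,
  ip_sym u x, ip_sym w x, ip_sym wbar x, ip_sym w u, ip_sym wbar u, ip_sym wbar w).
move=> Fu Fw Fwbar; rewrite -(ler_pM2l a0) in Fu.
rewrite -(ler_pM2l a0) in Fw; rewrite -(ler_pM2l a0) in Fwbar.
by move: Fu Fw Fwbar; lra.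
Qed.

(** * Asymptotic hulls and weak convergence *)

(** The parallelogram identity, applied to near-minimizers of the norm on a
    convex set. The weight [1 - 2^-1] is the form in which [convex_setP] gives
    the midpoint. *)
Lemma midpoint_sqdist (m : R) p q :
  m <= `|2^-1 *: p + (1 - 2^-1) *: q| ^+ 2 ->
  `|p - q| ^+ 2 <= 2 * `|p| ^+ 2 + 2 * `|q| ^+ 2 - 4 * m.
Proof. by rewrite -!hip !ipE (ip_sym q p) => h; lra. Qed.

(** Let [d n] be the least squared norm on [K n]; it is nondecreasing and
    bounded, hence convergent. Points [p n] of [K n] that nearly attain [d n] then
    form a Cauchy sequence by [midpoint_sqdist], and their limit is in every
    [K n]. *)
Lemma nested_closed_convex_meet (K : nat -> set H) (M : R) :
  (forall n, K n !=set0) -> (forall n, closed (K n)) ->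
  (forall n, convex_set (K n : set (convex_lmodType H))) ->
  (forall n m, (n <= m)%N -> K m `<=` K n) ->
  (forall p, K 0%N p -> `|p| <= M) ->
  (\bigcap_n K n) !=set0.
Proof.
move=> K0 Kcl Kcv Knest Kbd.
pose sq n := [set `|p| ^+ 2 | p in K n].
have sq0 n : has_lbound (sq n) by exists 0 => _ [p _ <-]; exact: sqr_ge0.
have infsq n : has_inf (sq n).
  by split; [case: (K0 n) => p Kp; exists (`|p| ^+ 2), p|].
pose d n := inf (sq n).
have dle n p : K n p -> d n <= `|p| ^+ 2 by move=> Kp; apply: ge_inf => //; exists p.
have d_nd : {homo d : n m / (n <= m)%N >-> n <= m}.
  move=> n m nm; apply: lb_le_inf; first by case: (infsq m).
  by move=> _ [p Kp <-]; apply/dle/(Knest _ _ nm).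
have cd : cvgn d.
  apply: nondecreasing_is_cvgn => //; exists (M ^+ 2) => _ [n _ <-].
  have [p Kp] := K0 n; apply: le_trans (dle _ _ Kp) _.
  have := Kbd _ (Knest 0%N n (leq0n _) _ Kp); have := normr_ge0 p; nra.
have /choice[p Hp] : forall n, exists p, K n p /\ `|p| ^+ 2 < d n + n.+1%:R^-1.
  move=> n; have n0 : 0 < n.+1%:R^-1 :> R by rewrite invr_gt0 ltr0n.
  by have [_ [p Kp <-] plt] := inf_adherent n0 (infsq n); exists p.
pose err n := 2 * (limn d - d n) + 4 * n.+1%:R^-1.
have perr n m : (n <= m)%N -> `|p n - p m| ^+ 2 <= err n.
  move=> nm; have [[Kn pn] [Km pm]] := (Hp n, Hp m).
  have Kmid : K n (2^-1 *: p n + (1 - 2^-1) *: p m).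
    have /convex_setP cK := Kcv n; apply: cK => //; [by lra|exact: Knest nm _ Km].
  have := midpoint_sqdist (dle _ _ Kmid).
  have mn : m.+1%:R^-1 <= n.+1%:R^-1 :> R.
    by rewrite lef_pV2 ?posrE ?ltr0n// ler_nat.
  have := nondecreasing_cvgn_le d_nd cd m.
  by rewrite /err; move: pn pm mn; move: (n.+1%:R^-1) (m.+1%:R^-1) => a b; lra.
have err0 : err n @[n --> \oo] --> 0.
  have -> : 0 = 2 * (limn d - limn d) + 4 * 0 :> R by rewrite subrr !mulr0 addr0.
  apply: cvgD; apply: cvgM; [exact: cvg_cst| |exact: cvg_cst|exact: cvg_harmonic].
  by apply: cvgB => //; exact: cvg_cst.
have cp : cvgn p.
  apply/cauchy_cvgP/cauchy_ballP => e e0.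
  have e2 : 0 < (e / 2) ^+ 2 by rewrite exprn_gt0// divr_gt0.
  have [N _ /(_ N (leqnn N)) errN] := cvgr_lt _ err0 _ e2.
  exists ([set q | ball (p N) (e / 2) q], [set q | ball (p N) (e / 2) q]).
    split; exists N => // m /= Nm; rewrite -ball_normE /=;
      by rewrite -ltr_sqr ?nnegrE ?divr_ge0 ?(ltW e0)// (le_lt_trans (perr _ _ Nm)).
  by move=> [a b] /= [ha hb]; exact: ball_splitr ha hb.
exists (limn p) => n _; apply: (closed_cvg _ (Kcl n) _ _ cp).
by exists n => // m /= nm; apply: (Knest _ _ nm); exact: (Hp m).1.
Qed.

(** This is the intersection over [n] of the closed convex hulls of the tails
    [x k], [k >= n]. It contains every weak cluster point of [x]. *)
Definition asymptotic_hull (x : nat -> H) : set H :=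
  [set p | forall D, closed D -> convex_set (D : set (convex_lmodType H)) ->
    (\forall k \near \oo, D (x k)) -> D p].

Lemma asymptotic_hull_nonempty (x : nat -> H) (M : R) :
  (forall k, `|x k| <= M) -> asymptotic_hull x !=set0.
Proof.
move=> xM.
pose tail n D := [/\ closed D, convex_set (D : set (convex_lmodType H))
  & forall k, (n <= k)%N -> D (x k)].
have [] := @nested_closed_convex_meet (fun n => \bigcap_(D in tail n) D) M.
- by move=> n; exists (x n) => D [_ _ xD]; exact: xD.
- by move=> n; apply: closed_bigI => D [].
- move=> n; apply/convex_setP => p q t t01 Kp Kq D tD.
  have [_ /convex_setP cD _] := tD.
  by apply: cD => //; [exact: Kp|exact: Kq].
- move=> n m nm p Kp D [clD cvD xD]; apply: Kp; split=> // k mk.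
  by apply: xD; exact: leq_trans mk.
- move=> p Kp; apply: (Kp [set q | `|q| <= M]); split=> [||k _]; last exact: xM.
  + by apply: preimage_closed (@closed_le R M) => q _; exact: norm_continuous.
  + apply/convex_setP => q r t /andP[t0 t1] /= qM rM.
    apply: le_trans (ler_normD _ _) _.
    rewrite !normrZ gtr0_norm// gtr0_norm ?subr_gt0//.
    by nra.
- move=> p Kp; exists p => D clD cvD [n _ xD].
  by apply: (Kp n I).
Qed.

(** The bound [n <= sigma n] carries eventual properties of [x] over to
    [x \o sigma], so the latter lies in more closed convex sets. *)
Lemma asymptotic_hull_subseq (x : nat -> H) (sigma : nat -> nat) :
  (forall n, (n <= sigma n)%N) ->
  asymptotic_hull (x \o sigma) `<=` asymptotic_hull x.
Proof.
move=> lesig p hp D clD cvD [N _ xD]; apply: hp => //.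
by exists N => // k /= Nk; apply/xD/(leq_trans Nk).
Qed.

Lemma closed_convex_halfspace v (a : R) :
  closed [set p | a <= ip p v] /\
  convex_set ([set p | a <= ip p v] : set (convex_lmodType H)).
Proof.
split.
  by apply: preimage_closed (@closed_ge R a) => p _; exact: continuous_ip.
apply/convex_setP => p q t /andP[t0 t1] /=; rewrite !(ipDl, ipZl); nra.
Qed.

Lemma asymptotic_hull_ge (x : nat -> H) v (a : R) p :
  (\forall k \near \oo, a <= ip (x k) v) -> asymptotic_hull x p -> a <= ip p v.
Proof.
move=> xa xp; have [clD cvD] := closed_convex_halfspace v a.
exact: (xp [set q | a <= ip q v]).
Qed.

(** Halfspaces are closed and convex, so the hull sees the limit of any scalar
    product along the sequence. *)
Lemma asymptotic_hull_lim (x : nat -> H) v (l : R) p :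
  ip (x k) v @[k --> \oo] --> l -> asymptotic_hull x p -> ip p v = l.
Proof.
move=> xl xp; apply/eqP; rewrite eq_le; apply/andP; split.
  apply/ler_addgt0Pr => e e0; rewrite -lerN2 -ipNr.
  apply: asymptotic_hull_ge xp.
  have : \forall k \near \oo, ip (x k) v < l + e.
    by apply: cvgr_lt xl _ _; rewrite ltrDl.
  by apply: filterS => k; rewrite ipNr lerN2 => /ltW.
apply/ler_addgt0Pl => e e0; rewrite -lerBlDl.
apply: asymptotic_hull_ge xp.
have : \forall k \near \oo, l - e < ip (x k) v.
  by apply: cvgr_gt xl _ _; rewrite ltrBlDr ltrDl.
by apply: filterS => k /ltW.
Qed.

(** Opial's lemma. For [z], [z'] in [S] the scalar products of [x k] with
    [z - z'] converge, being combinations of squared distances. Take [p] in the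
    hull of [x]. If [x] did not converge weakly to [p], some subsequence would stay
    in a closed halfspace missing [p], and so would a point [q] of the hull of that
    subsequence. But [p] and [q] are both in [S] and in the hull of [x], hence have
    the same scalar product with [p - q], and so coincide. *)
Lemma weak_convergence_criterion (x : nat -> H) (S : set H) :
  S !=set0 -> (forall z, S z -> cvgn (fun k => `|x k - z| ^+ 2)) ->
  asymptotic_hull x `<=` S ->
  exists2 z, S z & weakly_cvg ip x z.
Proof.
move=> [z0 Sz0] dcvg hullS.
have [M xM] : exists M, forall k, `|x k| <= M.
  have [M [_ /(_ (M + 1))]] := cvg_seq_bounded (dcvg _ Sz0).
  rewrite ltrDl => /(_ ltr01) bM; exists (M + 2 + `|z0|) => k.
  rewrite -(subrK z0 (x k)) (le_trans (ler_normD _ _))// lerD2r.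
  have := bM k I; rewrite /= ger0_norm ?sqr_ge0// => h.
  by have := normr_ge0 (x k - z0); nra.
have [p xp] := asymptotic_hull_nonempty xM.
exists p; first exact: hullS.
have diff_cvg z z' : S z -> S z' -> cvgn (fun k => ip (x k) (z - z')).
  move=> Sz Sz'.
  have -> : (fun k => ip (x k) (z - z')) = fun k =>
      2^-1 * (`|x k - z'| ^+ 2 - `|x k - z| ^+ 2 + (`|z| ^+ 2 - `|z'| ^+ 2)).
    by apply/funext => k; rewrite !sqnormB ipDr ipNr; field.
  apply: is_cvgM; first exact: is_cvg_cst.
  apply: is_cvgD; last exact: is_cvg_cst.
  by apply: is_cvgB; exact: dcvg.
have ev_lt v e : 0 < e -> \forall k \near \oo, ip (x k) v < ip p v + e.
  move=> e0; apply: contrapT => not_ev.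
  have /choice[sigma sigP] : forall n, exists k,
      (n <= k)%N /\ ip p v + e <= ip (x k) v.
    move=> n; apply: contrapT => none; apply: not_ev.
    exists n => // k /= nk; rewrite ltNge; apply/negP => ge_k.
    by apply: none; exists k.
  have [q xsq] := @asymptotic_hull_nonempty (x \o sigma) M (fun=> xM _).
  have xq : asymptotic_hull x q.
    by apply: asymptotic_hull_subseq xsq => n; exact: (sigP n).1.
  have qv : ip p v + e <= ip q v.
    by apply: asymptotic_hull_ge xsq; apply: nearW => n; exact: (sigP n).2.
  have cpq := diff_cvg _ _ (hullS _ xp) (hullS _ xq).
  have : ip (p - q) (p - q) = 0.
    rewrite ipDl ipNl (asymptotic_hull_lim cpq xp) (asymptotic_hull_lim cpq xq).
    exact: subrr.
  rewrite hip => /eqP; rewrite sqrf_eq0 normr_eq0 subr_eq0 => /eqP pq.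
  by move: qv; rewrite pq; lra.
move=> v; apply/cvgrPdist_lt => e e0.
near=> k.
have h1 : ip (x k) v < ip p v + e by near: k; exact: ev_lt.
have : ip (x k) (- v) < ip p (- v) + e by near: k; exact: ev_lt.
by rewrite !ipNr ltr_norml => h2; apply/andP; split; lra.
Unshelve. all: by end_near. Qed.

End Hilbert.

(** * Level sets of sums of convex functions *)

Section ExtendedConvex.
Variables (R : realType) (H : completeNormedModType R).
Implicit Types f g h : H -> \bar R.
Local Open Scope ereal_scope.

Lemma proper_sum_fin_num f g p :
  -oo < f p -> -oo < g p -> f p + g p < +oo ->
  f p \is a fin_num /\ g p \is a fin_num.
Proof. by case: (f p) => [a||]; case: (g p) => [b||]. Qed.

(** A real number below [f p + g p] is at most a sum of two real numbers that lie
    strictly below [f p] and [g p]; infinite values are the reason for the case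
    analysis. *)
Lemma lower_semicontinuousD f g :
  (forall p, -oo < f p) -> (forall p, -oo < g p) ->
  lower_semicontinuous f -> lower_semicontinuous g ->
  lower_semicontinuous (f \+ g).
Proof.
move=> fNy gNy flsc glsc p a /= afg.
have [b [c [bf cg abc]]] :
    exists b c : R, [/\ b%:E < f p, c%:E < g p & (a <= b + c)%R].
  move: (fNy p) (gNy p) afg; case: (f p) => [r||//] _; case: (g p) => [s||//] _.
  - rewrite -EFinD lte_fin => ars.
    exists (r - (r + s - a) / 2)%R, (s - (r + s - a) / 2)%R.
    by rewrite !lte_fin; split; lra.
  - by move=> _; exists (r - 1)%R, (a - r + 1)%R; rewrite lte_fin ltry; split=> //; lra.
  - by move=> _; exists (a - s + 1)%R, (s - 1)%R; rewrite lte_fin ltry; split=> //; lra.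
  - by move=> _; exists a, 0%R; rewrite !ltry addr0.
have [U pU fU] := flsc _ _ bf; have [V pV gV] := glsc _ _ cg.
exists (U `&` V); first exact: filterI.
move=> q [/fU bq /gV cq]; apply: le_lt_trans (lteD bq cq).
by rewrite -EFinD lee_fin.
Qed.

Lemma level_set_closed (C : set H) h (a : R) :
  closed C -> lower_semicontinuous h -> closed (level_set C h a).
Proof.
move=> clC /lower_semicontinuousP hlsc.
have -> : level_set C h a = C `&` ~` [set p | a%:E < h p].
  apply/seteqP; split=> p [Cp hp]; split=> //=; first by apply/negP; rewrite -leNgt.
  by rewrite leNgt; apply/negP.
by apply: closedI => //; apply: open_closedC.
Qed.

Lemma level_set_sum_convex (C : set H) f g (a : R) :
  convex_set (C : set (convex_lmodType H)) ->
  (forall p, -oo < f p) -> (forall p, -oo < g p) ->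
  convex_efun f -> convex_efun g ->
  convex_set (level_set C (f \+ g) a : set (convex_lmodType H)).
Proof.
move=> /convex_setP cC fNy gNy cf cg; apply/convex_setP => p q t t01 [Cp hp] [Cq hq].
split; first exact: cC.
have [fp gp] := proper_sum_fin_num (fNy p) (gNy p) (le_lt_trans hp (ltry _)).
have [fq gq] := proper_sum_fin_num (fNy q) (gNy q) (le_lt_trans hq (ltry _)).
apply: le_trans (leeD (cf p q t t01) (cg p q t t01)) _.
move: hp hq; rewrite /= -(fineK fp) -(fineK fq) -(fineK gp) -(fineK gq).
rewrite -!EFinM -!EFinD !lee_fin; have /andP[t0 t1] := t01; nra.
Qed.

End ExtendedConvex.

(** * Convergence of the method *)

Theorem theorem4 (R : realType) (H : completeNormedModType R)
  (ip : {dot H for idfun}) (hip : induces_norm ip)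
  (f g : H -> \bar R)
  (hf : proper_closed_convex f) (hg : proper_closed_convex g)
  (C : set H) (C_nonempty : C !=set0) (C_closed : closed C)
  (C_convex : convex_set (C : set (convex_lmodType H)))
  (dom_gf : dom g `<=` dom f) (C_int : C `<=` interior (dom g))
  (r alpha eps : R^nat) (x y u xbar wbar : nat -> H)
  (hx : absolute_error_method ip f g C r alpha eps x y u xbar wbar)
  (gamma s : R^nat) (w : nat -> H)
  (gamma_lo gamma_hi stilde c epslim : R)
  (halpha : forall k, alpha k =
     gamma k * ((fine ((f \+ g)%E (x k)) - s k - eps k) / `|u k + w k| ^+ 2))
  (hgamma_lo : 0 < gamma_lo) (hgamma_hi : gamma_hi < 2)
  (hgamma : forall k, gamma_lo <= gamma k <= gamma_hi)
  (s_decr : nonincreasing_seq s)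
  (s_cvg : s k @[k --> \oo] --> stilde)
  (s_lt : forall k, ((s k + eps k)%:E < (f \+ g) (x k))%E)
  (hw : forall k, subdiff ip 0 g (x k) (w k))
  (hc : 0 < c)
  (hbound : forall k, Num.max `|wbar k| (Num.max `|w k| `|u k|) <= c)
  (hepslim : 0 <= epslim)
  (eps_cvg : eps k @[k --> \oo] --> epslim)
  (L_nonempty : level_set C (f \+ g)%E stilde !=set0) :
  [/\ quasi_Fejer x (level_set C (f \+ g)%E stilde),
      (f \+ g)%E (x k) @[k --> \oo] --> (stilde + epslim)%:E
    & epslim = 0 ->
      exists2 z, level_set C (f \+ g)%E stilde z & weakly_cvg ip x z].
Proof.
have [[fNy _] flsc fcvx] := hf; have [[gNy _] glsc gcvx] := hg.
case: hx => x0 r0 rsum a0 eps0 hu hy hwbar herr hstep.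
have finC q : C q -> f q \is a fin_num /\ g q \is a fin_num.
  move=> /C_int /interior_subset gq; have fq := dom_gf _ gq.
  by rewrite !fin_numElt fNy gNy.
have xC k : C (x k) by case: k => [//|k]; exact: (hstep k).1.
have Ffin k : (f \+ g)%E (x k) \is a fin_num.
  by have [fx gx] := finC _ (xC k); rewrite fin_numD fx.
pose F k := fine ((f \+ g)%E (x k)).
pose phi k := F k - s k - eps k.
have phi0 k : 0 < phi k.
  by have := s_lt k; rewrite -(fineK (Ffin k)) lte_fin -/(F k) /phi; lra.
have s_ge k : stilde <= s k.
  rewrite -(cvg_lim _ s_cvg)//; apply: nonincreasing_cvgn_ge => //.
  exact: cvgP s_cvg.
(* From [gamma (2 - gamma) >= gamma_lo (2 - gamma_hi)] and [|u + w| <= 2 c]. *)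
pose K := gamma_lo * (2 - gamma_hi) / (4 * c ^+ 2).
have K0 : 0 < K by rewrite divr_gt0 ?mulr_gt0 ?exprn_gt0 ?subr_gt0.
have decrease z k : level_set C (f \+ g)%E stilde z ->
    `|x k.+1 - z| ^+ 2 <= `|x k - z| ^+ 2 - K * phi k ^+ 2 + r k ^+ 2.
  move=> [Cz Fz].
  have [[fx gx] [fz gz]] := (finC _ (xC k), finC _ Cz).
  have := one_step_estimate hip C_convex Cz (a0 k) gNy fx gx fz gz (hu k) (hw k)
    (hwbar k).
  rewrite -hy => /(_ _ _ (herr k) (hstep k)).
  move: Fz; rewrite /= -(fineK fz) -(fineK gz) -EFinD lee_fin.
  rewrite -(fineD fx gx) -/(F k).
  set Fz := fine (f z) + _ => Fz_le.
  have := a0 k; rewrite halpha -/(F k) -/(phi k).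
  set Q := `|u k + w k| ^+ 2 => ak step.
  (* A zero denominator would make the stepsize vanish. *)
  have Q0 : 0 < Q.
    rewrite lt_neqAle sqr_ge0 andbT eq_sym; apply/eqP => Q0.
    by move: ak; rewrite Q0 invr0 !mulr0 ltxx.
  have Qc : Q <= 4 * c ^+ 2.
    have := hbound k; rewrite !ge_max => /and3P[_ wc uc].
    have := ler_normD (u k) (w k); have := normr_ge0 (u k + w k).
    by rewrite /Q; nra.
  apply: le_trans step _; rewrite lerD2r.
  have /andP[glo ghi] := hgamma k.
  set a := gamma k * _ in ak *.
  have aQ : a * Q = gamma k * phi k by rewrite /a mulrA mulfVK ?gt_eqF.
  have Kle : K * phi k ^+ 2 <= a * (2 - gamma k) * phi k.
    have -> : a * (2 - gamma k) * phi k = gamma k * (2 - gamma k) / Q * phi k ^+ 2.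
      by rewrite /a; ring.
    rewrite ler_pM2r ?exprn_gt0//; apply: ler_pM.
    - by rewrite mulr_ge0 ?subr_ge0 ?ltW.
    - by rewrite invr_ge0 mulr_ge0 ?sqr_ge0.
    - by apply: ler_pM; lra.
    - by rewrite lef_pV2 ?posrE// mulr_gt0 ?exprn_gt0.
  have phi_le : a * phi k <= a * (F k - Fz - eps k).
    by rewrite ler_pM2l// /phi; have := s_ge k; lra.
  have : a ^+ 2 * Q = a * (gamma k * phi k) by rewrite -aQ; ring.
  by lra.
have convergences z : level_set C (f \+ g)%E stilde z ->
    cvgn (fun k => `|x k - z| ^+ 2) /\ K * phi k ^+ 2 @[k --> \oo] --> 0.
  move=> Lz; apply: (perturbed_decrease _ _ rsum) => k.
  - exact: sqr_ge0.
  - by rewrite mulr_ge0 ?sqr_ge0 ?ltW.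
  - exact: decrease.
have phi_cvg : phi k @[k --> \oo] --> 0.
  have [z Lz] := L_nonempty; have [_ phi2] := convergences z Lz.
  apply/cvgrPdist_lt => e e0.
  have : \forall k \near \oo, K * phi k ^+ 2 < K * e ^+ 2.
    by apply: cvgr_lt phi2 _ _; rewrite mulr_gt0 ?exprn_gt0.
  apply: filterS => k; rewrite ltr_pM2l// ltr_sqr ?nnegrE ?ltW// => h.
  by rewrite sub0r normrN gtr0_norm.
have F_cvg : F k @[k --> \oo] --> stilde + epslim.
  have -> : F = fun k => phi k + (s k + eps k).
    by apply/funext => k; rewrite /phi; ring.
  rewrite -[X in _ --> X]add0r.
  by apply: cvgD phi_cvg _; exact: cvgD.
split.
- split=> // z Lz; exists (fun k => r k ^+ 2) => [|k].
    (* The errors [r k ^+ 2] are nonnegative, so the normed series is theirs. *)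
    rewrite [X in cvgn X](_ : _ = series (fun k => r k ^+ 2))//.
    by congr series; apply/funext => k; rewrite /= ger0_norm ?sqr_ge0.
  have := decrease z k Lz; have : 0 <= K * phi k ^+ 2 by rewrite mulr_ge0 ?sqr_ge0 ?ltW.
  by lra.
- by apply: cvg_EFin => //; exact: nearW.
- move=> epslim0; rewrite epslim0 addr0 in F_cvg.
  apply: weak_convergence_criterion => //.
    by move=> z /convergences[].
  move=> p xp.
  have Lp e : 0 < e -> level_set C (f \+ g)%E (stilde + e) p.
    move=> e0; apply: xp.
    + by apply: level_set_closed => //; exact: lower_semicontinuousD.
    + exact: level_set_sum_convex.
    have : \forall k \near \oo, F k < stilde + e.
      by apply: cvgr_lt F_cvg _ _; rewrite ltrDl.
    apply: filterS => k /ltW Fk; split; first exact: xC.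
    by rewrite -(fineK (Ffin k)) lee_fin.
  split; first exact: (Lp 1 ltr01).1.
  by apply/lee_addgt0Pr => e e0; rewrite -EFinD; exact: (Lp e e0).2.
Qed.
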